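(* Let $X,Y$ be arbitrarily dependent random variables with distributions $F,G\in\mathcal{OT}$. Then for every $p\in(0,1)$ the mixture satisfies $pF+(1-p)G\in\mathcal{OT}$; that is, the class $\mathcal{OT}$ is closed with respect to finite mixture.
   Context: For a distribution $F$, $\overline F(x)=1-F(x)$ denotes its tail; all distributions satisfy $\overline F(x)>0$ for every $x\ge0$. Classes of distributions: - $F\in\mathcal{P_D}$ (positively decreasing) if $\limsup_{x\to\infty}\overline F(vx)/\overline F(x)<1$ for some $v>1$. - $F\in\mathcal{OL}$ (generalized long-tailed) if $\limsup_{x\to\infty}\overline F(x-t)/\overline F(x)<\infty$ for every $t\neq 0$. - $\mathcal{OT}:=\mathcal{OL}\cap\mathcal{P_D}$. *)

(* Defs.v *)
From mathcomp Require Import all_boot all_order all_algebra.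
From mathcomp Require Import all_classical all_reals all_analysis.
Import Order.TTheory GRing.Theory Num.Theory numFieldNormedType.Exports.

Set Implicit Arguments.
Unset Strict Implicit.
Unset Printing Implicit Defensive.

Local Open Scope classical_set_scope.
Local Open Scope ring_scope.

Definition tail (R : realType) (F : R -> R) (x : R) : R := 1 - F x.

(* The last clause is the standing assumption on all distributions; it makes
   the quotients of tails below meaningful for all x large enough. *)
Definition distribution_fun (R : realType) (F : R -> R) : Prop :=
  [/\ nondecreasing F, right_continuous F, F @ -oo --> (0 : R),
      F @ +oo --> (1 : R) & forall x, 0 <= x -> 0 < tail F x].

(* The limsup is taken in the extended reals, so that it always exists. *)
Definition limsup_pinfty (R : realType) (f : R -> R) : \bar R :=
  limf_esup (fun x => (f x)%:E) (pinfty_nbhs R).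

Definition PD (R : realType) (F : R -> R) : Prop :=
  distribution_fun F /\
  exists v : R,
    1 < v /\ (limsup_pinfty (fun x => (tail F (v * x) / tail F x)%R) < 1%:E)%E.

Definition OL (R : realType) (F : R -> R) : Prop :=
  distribution_fun F /\
  forall t : R, t != 0 ->
    (limsup_pinfty (fun x => (tail F (x - t) / tail F x)%R) < +oo)%E.

Definition OT (R : realType) (F : R -> R) : Prop := OL F /\ PD F.

(* cdf takes values in the extended reals; they are all finite. *)
Definition distr_of d (T : measurableType d) (R : realType)
    (P : probability T R) (X : {RV P >-> R}) : R -> R :=
  fun x => fine (cdf X x).

Definition closed_under_finite_mixture (R : realType) (C : (R -> R) -> Prop) :
    Prop :=
  forall (n : nat) (w : 'I_n -> R) (F : 'I_n -> R -> R),
    (forall i, 0 < w i) -> \sum_(i < n) w i = 1 ->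
    (forall i, C (F i)) -> C (fun x => \sum_(i < n) w i * F i x).

(* Main.v *)
(** The tail of a mixture is the mixture of the tails, so an eventual bound
    [tail F_i (h x) <= c * tail F_i x] with a constant [c] common to all the
    components passes to the mixture.  For [OL] the largest of the finitely many
    constants is taken.  The scale [v] in [PD] depends on the component, but tails
    are nonincreasing, so [v] may be replaced by any larger scale with the same
    constant [c < 1]: the largest scale and the largest constant then serve all
    components at once. *)
Require Import Defs.
From mathcomp Require Import all_boot all_order all_algebra.
From mathcomp Require Import all_classical all_reals all_analysis.
Import Order.TTheory GRing.Theory Num.Theory numFieldNormedType.Exports.

Local Open Scope ring_scope.

(** The limsup is an infimum of suprema over neighbourhoods of [+oo]; being below [y] strictly, it
    lets one such supremum serve as [c]. Both defining conditions thus become eventual real bounds,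
    with [y] equal to [1] or [+oo]. *)
Lemma limsup_pinfty_ltP (R : realType) (f : R -> R) (y : \bar R) :
  (limsup_pinfty f < y)%E <->
  exists2 c : R, (c%:E < y)%E & \forall x \near +oo, f x <= c.
Proof.
split=> [/ereal_inf_lt[_ [V Voo <-]] supVy|[c cy fc]].
  have ubV x : V x -> ((f x)%:E <= ereal_sup [set (f z)%:E | z in V])%E.
    by move=> Vx; apply: ereal_sup_ubound; exists x.
  have [x0 Vx0] := filter_ex Voo.
  (* The supremum cannot be [+oo], as it is below [y], nor [-oo], as [V] contains the point [x0]. *)
  case: (ereal_sup _) supVy ubV (ubV x0 Vx0) => [c cy ubV _|+ _ _|//].
    exists c => //.
    by apply: filterS Voo => x /ubV; rewrite lee_fin.
  by rewrite ltNge leey.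
apply: le_lt_trans cy; apply: (@le_trans _ _
    (ereal_sup [set (f z)%:E | z in [set x | f x <= c]]%classic)).
  by apply: ereal_inf_lbound; exists [set x | f x <= c]%classic.
by apply: ge_ereal_sup => _ [z fz <-]; rewrite lee_fin.
Qed.

Lemma limsup_tail_scale_ratio_le (R : realType) (F : R -> R) (u v : R)
    (y : \bar R) :
  distribution_fun F -> u <= v ->
  (limsup_pinfty (fun x => (tail F (u * x) / tail F x)%R) < y)%E ->
  (limsup_pinfty (fun x => (tail F (v * x) / tail F x)%R) < y)%E.
Proof.
move=> [ndF _ _ _ tail_gt0] uv /limsup_pinfty_ltP[c cy uc].
apply/limsup_pinfty_ltP; exists c => //.
(* For [x >= 0] the denominator is positive and [u * x <= v * x]. *)
apply: filterS2 (nbhs_pinfty_ge (num_real 0)) uc => x x0; apply: le_trans.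
by rewrite ler_pM2r ?invr_gt0 ?tail_gt0// lerB// ndF// ler_wpM2r.
Qed.

Section Mixture.
Variables (R : realType) (n : nat) (w : 'I_n -> R) (F : 'I_n -> R -> R).
Hypotheses (w_gt0 : forall i, 0 < w i) (w_sum1 : \sum_(i < n) w i = 1).

Let mix (x : R) : R := \sum_(i < n) w i * F i x.

Let tail_mix x : tail mix x = \sum_(i < n) w i * tail (F i) x.
Proof.
rewrite /tail /mix -[X in X - _]w_sum1 -sumrB.
by apply: eq_bigr => i _; rewrite mulrBr mulr1.
Qed.

(** The filter is arbitrary so that right continuity and both limits at infinity follow at once. *)
Let cvg_mix (T : Type) (A : set_system T) (FA : Filter A) (g : T -> R)
    (l : 'I_n -> R) :
  (forall i, (F i (g x) @[x --> A] --> l i)%classic) ->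
  (mix (g x) @[x --> A] --> \sum_(i < n) w i * l i)%classic.
Proof.
move=> Fl.
rewrite /mix.
elim: (index_enum _) => [|i s IHs].
  by rewrite big_nil; under eq_fun do rewrite big_nil; exact: cvg_cst.
rewrite big_cons; under eq_fun do rewrite big_cons.
by apply: cvgD => //; apply: cvgMr.
Qed.

Lemma distribution_fun_mixture :
  (forall i, distribution_fun (F i)) -> distribution_fun mix.
Proof.
move=> dF; split.
- move=> x y xy; apply: ler_sum => i _.
  by have [ndF _ _ _ _] := dF i; rewrite ler_pM2l// ndF.
- by move=> x; apply: cvg_mix => i; have [_ rcF _ _ _] := dF i; exact: rcF.
- have -> : (0 : R) = \sum_(i < n) w i * 0.
    by rewrite big1// => i _; rewrite mulr0.
  by apply: (cvg_mix _ _ _ id) => i; have [] := dF i.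
- have -> : (1 : R) = \sum_(i < n) w i * 1.
    by rewrite -[LHS]w_sum1; apply: eq_bigr => i _; rewrite mulr1.
  by apply: (cvg_mix _ _ _ id) => i; have [] := dF i.
- move=> x x0; rewrite tail_mix.
  have wF_gt0 i : 0 < w i * tail (F i) x.
    by have [_ _ _ _ /(_ x x0) tF] := dF i; rewrite mulr_gt0.
  (* Strict positivity needs at least one component; without any, the weights would sum to 0. *)
  have [i _|no] := pickP (fun _ : 'I_n => true); last first.
    by move/eqP: w_sum1; rewrite big_pred0// eq_sym oner_eq0.
  by rewrite (bigD1 i)//= ltr_wpDr// sumr_ge0// => j _; exact/ltW.
Qed.

(** Covers shifts [h x = x - t] with [y = +oo] and scalings [h x = v * x] with [y = 1]. *)
Lemma limsup_tail_ratio_mixture (h : R -> R) (y : \bar R) : (0 < y)%E ->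
  (forall i, distribution_fun (F i)) ->
  (forall i,
    (limsup_pinfty (fun x => (tail (F i) (h x) / tail (F i) x)%R) < y)%E) ->
  (limsup_pinfty (fun x => (tail mix (h x) / tail mix x)%R) < y)%E.
Proof.
move=> y0 dF ratioF; apply/limsup_pinfty_ltP.
have /choice[c cP] : forall i, exists c : R, (c%:E < y)%E /\
    \forall x \near +oo, tail (F i) (h x) / tail (F i) x <= c.
  by move=> i; have /limsup_pinfty_ltP[c] := ratioF i; exists c.
(* The default 0 is below [y] by assumption, so the maximum stays below [y]. *)
exists (\big[Num.max/0]_i c i).
  elim/big_ind : _ => // [a b ay yb|i _]; last by have [] := cP i.
  by rewrite /Num.max; case: ifP.
have ratio_le : \forall x \near +oo,
    forall i, tail (F i) (h x) / tail (F i) x <= c i.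
  by apply: filter_forall => i; exact: (cP i).2.
have [_ _ _ _ tail_gt0] := distribution_fun_mixture dF.
apply: filterS2 (nbhs_pinfty_ge (num_real 0)) ratio_le => x x0 rx.
rewrite ler_pdivrMr ?tail_gt0// !tail_mix mulr_sumr; apply: ler_sum => i _.
have [_ _ _ _ /(_ x x0) tF] := dF i.
rewrite mulrCA ler_pM2l//; move: (rx i); rewrite ler_pdivrMr// => /le_trans; apply.
by rewrite ler_pM2r// le_bigmax.
Qed.

Lemma OL_mixture : (forall i, OL (F i)) -> OL mix.
Proof.
move=> oF; split; first by apply: distribution_fun_mixture => i; case: (oF i).
move=> t t0; apply: limsup_tail_ratio_mixture => // i; first by case: (oF i).
by case: (oF i) => _; apply.
Qed.

Lemma PD_mixture : (forall i, PD (F i)) -> PD mix.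
Proof.
move=> pF; have dF i : distribution_fun (F i) by case: (pF i).
split; first exact: distribution_fun_mixture.
have /choice[v vP] : forall i, exists v : R, 1 < v /\
    (limsup_pinfty (fun x => (tail (F i) (v * x) / tail (F i) x)%R) < 1%:E)%E.
  by move=> i; case: (pF i).
(* The default 2 makes the common scale exceed 1 outright. *)
exists (\big[Num.max/2]_i v i); split.
  by apply: lt_le_trans (bigmax_ge_id _ _ _ _); rewrite ltr1n.
apply: limsup_tail_ratio_mixture => // i.
apply: limsup_tail_scale_ratio_le (vP i).2 => //; exact: le_bigmax.
Qed.

End Mixture.

Lemma closed_under_finite_mixture_OT (R : realType) :
  closed_under_finite_mixture (@OT R).
Proof.
move=> n w F w_gt0 w_sum1 otF; split.
- by apply: OL_mixture => // i; case: (otF i).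
- by apply: PD_mixture => // i; case: (otF i).
Qed.

Theorem mainTheorem4 (R : realType) :
  (forall (d : measure_display) (T : measurableType d) (P : probability T R)
     (X Y : {RV P >-> R}),
     OT (distr_of X) -> OT (distr_of Y) ->
     forall p : R, 0 < p -> p < 1 ->
       OT (fun x => p * distr_of X x + (1 - p) * distr_of Y x))
  /\ closed_under_finite_mixture (@OT R).
Proof.
split; last exact: closed_under_finite_mixture_OT.
move=> d T P X Y otX otY p p0 p1.
pose w (i : 'I_2) := if i == ord0 then p else 1 - p.
pose F (i : 'I_2) := if i == ord0 then distr_of X else distr_of Y.
rewrite [X in OT X](_ : _ = fun x => \sum_(i < 2) w i * F i x); last first.
  by apply/funext => x; rewrite big_ord_recl big_ord1.
apply: closed_under_finite_mixture_OT => [i||i].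
- by rewrite /w; case: ifP; rewrite ?subr_gt0.
- by rewrite big_ord_recl big_ord1 /w /= addrC subrK.
- by rewrite /F; case: ifP.
Qed.
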